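(* Let $G_1,G_2$ be flat pregeometries and let $H$ be a flat pregeometry with $H=G_1\cap G_2$ (the underlying set of $H$ is the intersection of the underlying sets of $G_1$ and $G_2$, and $H$ is a subpregeometry of both), such that $H\sqsubseteq G_1$ and $H\sqsubseteq G_2$. Then there exists a flat pregeometry $G$ such that $G_1\sqsubseteq G$ and $G_2\sqsubseteq G$. Moreover, $G$ is defined on the union of the underlying sets of $G_1$ and $G_2$.
   Context: Pregeometries. A pregeometry $G$ on a (possibly infinite) set $M$ is a function $d=d_G$ from the finite subsets of $M$ to $\mathbb{N}$ such that $d(\emptyset)=0$, $d(A)\le d(A\cup\{x\})\le d(A)+1$, and $d(A\cup B)+d(A\cap B)\le d(A)+d(B)$. A finite $A$ is independent if $d(A)=|A|$; an arbitrary set is independent if all its finite subsets are; $d(Y)=\sup\{|Y_0|: Y_0\subseteq Y \text{ independent}\}$ for arbitrary $Y$. For finite $A$, $\mathrm{cl}_G(A)=\{x: d(A\cup\{x\})=d(A)\}$, and $\mathrm{cl}_G(Y)=\bigcup\{\mathrm{cl}_G(Y_0): Y_0\subseteq Y\text{ finite}\}$. $Y$ is closed in $G$ if $\mathrm{cl}_G(Y)=Y$. A subpregeometry $H\subseteq G$ is the restriction of $d_G$ to subsets of a subset of $M$; subsets and subpregeometries are identified. Flatness. For a finite collection $\Sigma=\{E_1,\dots,E_k\}$ of finite-dimensional closed sets of $G$ let $\Delta_G(\Sigma)=\sum_{\emptyset\ne s\subseteq\{1,\dots,k\}}(-1)^{|s|+1}d_G\left(\bigcap_{i\in s}E_i\right)$.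 $G$ is flat if $\Delta_G(\Sigma)\ge d_G(\bigcup\Sigma)$ for every such $\Sigma$. Strong embedding. For $H\subseteq G$, $H\sqsubseteq G$ means that for every finite collection $\Sigma$ of finite-dimensional closed sets of $G$, $\Delta_H(\{E\cap H: E\in\Sigma\})\le\Delta_G(\Sigma)$. *)

(* Defs.v *)
(* Library world: MathComp (with finmap and the classical sets of
   MathComp-Analysis). *)
From mathcomp Require Import all_boot all_order all_algebra finmap.
From mathcomp Require Import boolp classical_sets.

Set Implicit Arguments.
Unset Strict Implicit.
Unset Printing Implicit Defensive.

Import Order.TTheory GRing.Theory Num.Theory.

Local Open Scope nat_scope.
Local Open Scope classical_set_scope.

(* Pregeometries live on arbitrary subsets of an ambient type, so that
   intersections and unions of underlying sets make sense. The values of [rk]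
   on finite sets not included in [carrier] are irrelevant. *)
Record pregeometry (T : choiceType) := Pregeometry {
  carrier : set T;
  rk : {fset T} -> nat;
  rk_fset0 : rk fset0 = 0;
  rk_step : forall (A : {fset T}) (x : T),
    [set` A] `<=` carrier -> carrier x ->
    (rk A <= rk (x |` A)%fset <= (rk A).+1)%N;
  rk_submod : forall A B : {fset T},
    [set` A] `<=` carrier -> [set` B] `<=` carrier ->
    (rk (A `|` B)%fset + rk (A `&` B)%fset <= rk A + rk B)%N }.

Section Pregeometry.
Variables (T : choiceType) (G : pregeometry T).

Definition independent (A : {fset T}) : Prop := rk G A = #|` A|.

(* An arbitrary set is independent when all its finite subsets are; an infinite
   one thus has finite independent subsets of every size, and d(Y) is already
   the supremum of the sizes of the finite independent subsets of [Y]. *)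
Definition indep_sizes (Y : set T) : set nat :=
  [set n | exists A : {fset T},
     [/\ [set` A] `<=` Y, independent A & #|` A| = n]].

Definition finite_dim (Y : set T) : Prop := has_ubound (indep_sizes Y).

(* [pdim Y] is d(Y) when [finite_dim Y], and the junk value 0 when d(Y) is
   infinite; it is only used on finite-dimensional sets. *)
Definition pdim (Y : set T) : nat := supremum 0 (indep_sizes Y).

Definition cl_fin (A : {fset T}) : set T :=
  [set x | carrier G x /\ rk G (x |` A)%fset = rk G A].

Definition cl (Y : set T) : set T :=
  \bigcup_(A in [set A : {fset T} | [set` A] `<=` Y]) cl_fin A.

(* This forces [Y `<=` carrier G]. *)
Definition closed_in (Y : set T) : Prop := cl Y = Y.

(* A finite collection is an indexed family, possibly with repetitions, which
   do not change the alternating sum. *)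
Definition Delta (k : nat) (E : 'I_k -> set T) : int :=
  (\sum_(s : {set 'I_k} | s != finset.set0)
     (-1) ^+ (#|s|.+1) * (pdim (\bigcap_(i in [set` s]) E i))%:Z)%R.

Definition fd_closed_family (k : nat) (E : 'I_k -> set T) : Prop :=
  forall i, closed_in (E i) /\ finite_dim (E i).

Definition flat : Prop :=
  forall (k : nat) (E : 'I_k -> set T), fd_closed_family E ->
    ((pdim (\bigcup_i E i))%:Z <= Delta E)%R.

End Pregeometry.

Definition subpregeometry (T : choiceType) (H G : pregeometry T) : Prop :=
  carrier H `<=` carrier G /\
  forall A : {fset T}, [set` A] `<=` carrier H -> rk H A = rk G A.

Definition strong (T : choiceType) (H G : pregeometry T) : Prop :=
  subpregeometry H G /\
  forall (k : nat) (E : 'I_k -> set T), fd_closed_family G E ->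
    (Delta H (fun i => E i `&` carrier H) <= Delta G E)%R.

(* Main.v *)
Require Import Defs.
From mathcomp Require Import all_boot all_order all_algebra finmap.
From mathcomp Require Import boolp classical_sets.
From mathcomp Require Import zify.

Set Implicit Arguments.
Unset Strict Implicit.
Unset Printing Implicit Defensive.

Import Order.TTheory GRing.Theory Num.Theory.

Local Open Scope nat_scope.
Local Open Scope classical_set_scope.

(** The amalgam is the free one. Call a subset E of the union of G1 and G2
    glued-closed when it traces a finite-dimensional closed set on each of them,
    and put
      glued_dim E = d1 (E n G1) + d2 (E n G2) - d_H (E n H).
    The predimension of a finite family S of such sets is the
    inclusion-exclusion sum of glued_dim over S, and the rank of a finite A in
    the amalgam is the least predimension of a family covering A. In terms of
    hypergraphs, a family stands for the union of the subhypergraphs induced on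
    its members, and its predimension counts vertices minus edges; flatness says
    that the predimension of a family dominates the dimension of its union, and
    strength that the part of a family outside H has nonnegative predimension.

    Inclusion-exclusion is modular ([incl_excl_meets]): the values at the
    concatenation of two families and at the family of their pairwise
    intersections add up to the values at the two families. As these two
    families cover exactly the union and the intersection of the sets covered,
    submodularity of the rank follows at once. Strength of H in G2 and flatness
    of G1 bound a predimension below by the rank in G1 ([glue_lower_bound]),
    and closing up a set of G1 inside G2 attains the bound ([glue_extend]); so
    the amalgam extends G1, and symmetrically G2.

    The heart of the matter is [pdim_amalgam]: on a finite-dimensional closed
    set of the amalgam the dimension is glued_dim. A family S of least
    predimension covering a large enough finite subset of E lies inside E and
    spans the traces of E on G1, G2 and H. The relative form of flatness
    [strong_rel_dim_le] then shows that enlarging S to the single set E does not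
    increase the predimension. Consequently the alternating sum of the amalgam
    is Delta_1 + Delta_2 - Delta_H, a predimension ([Delta_amalgam]). Flatness
    is now the definition of the rank, and strength of G1 reduces to
    Delta_H <= Delta_2, which is strength of H in G2. *)

(** * Inclusion-exclusion over finite families of sets *)

Section InclusionExclusion.
Variable T : choiceType.
Implicit Types (f g : set T -> int) (A B E F : set T) (S R : seq (set T)).

(** The sum over all subfamilies s of S, the empty one included, of
    (-1)^|s| f (B n bigcap s). It is the linear extension of f applied to the
    product of B and of the factors 1 - E, for E in S, in the ring of formal
    combinations of sets with intersection as product. Carrying B along makes
    every identity below an induction on S. *)
Fixpoint alt_sum f B S : int :=
  if S is E :: S' then (alt_sum f B S' - alt_sum f (B `&` E) S')%R else f B.

(** The value of f at the whole type is the contribution of the empty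
    subfamily, and cancels. *)
Definition incl_excl f S : int := (f setT - alt_sum f setT S)%R.

Definition meets S R : seq (set T) := [seq E `&` F | E <- S, F <- R].

Definition cover S : set T := \bigcup_(E in [set` S]) E.

Lemma cover_cons E S : cover (E :: S) = E `|` cover S.
Proof.
rewrite /cover; apply/seteqP; split => [x [F /=]|x].
  by rewrite inE => /orP[/eqP->|FS] Fx; [left|right; exists F].
case=> [Ex|[F FS Fx]]; first by exists E; rewrite //= inE eqxx.
by exists F; rewrite //= inE FS orbT.
Qed.

Lemma cover_cat S R : cover (S ++ R) = cover S `|` cover R.
Proof.
elim: S => [|E S IH] /=; first by rewrite /cover set_nil bigcup_set0 set0U.
by rewrite !cover_cons IH setUA.
Qed.

Lemma cover_meets S R : cover (meets S R) = cover S `&` cover R.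
Proof.
apply/seteqP; split => [x [_ /= /allpairsP[[E F] /= [ES FR ->]] [Ex Fx]]|].
  by split; [exists E|exists F].
move=> x [[E ES Ex] [F FR Fx]]; exists (E `&` F) => //=.
by apply/allpairsP; exists (E, F).
Qed.

(** Summing over the subfamilies of R first turns concatenation into iteration,
    with the inner sum as the new set function. *)
Lemma alt_sum_cat f B S R :
  alt_sum f B (S ++ R) = alt_sum (fun X => alt_sum f X R) B S.
Proof. by elim: S B => //= E S IH B; rewrite !IH. Qed.

Lemma eq_alt_sum f g B S : f =1 g -> alt_sum f B S = alt_sum g B S.
Proof. by move=> fg; elim: S B => //= E S IH B; rewrite !IH. Qed.

Lemma alt_sumB f g B S :
  alt_sum (fun X => f X - g X)%R B S = (alt_sum f B S - alt_sum g B S)%R.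
Proof. by elim: S B => //= E S IH B; rewrite !IH; lia. Qed.

Lemma alt_sumD f g B S :
  alt_sum (fun X => f X + g X)%R B S = (alt_sum f B S + alt_sum g B S)%R.
Proof. by elim: S B => //= E S IH B; rewrite !IH; lia. Qed.

Lemma alt_sum_shift f A B S :
  alt_sum (fun X => f (X `&` A)) B S = alt_sum f (B `&` A) S.
Proof. by elim: S B => //= E S IH B; rewrite !IH setIAC. Qed.

(** The factor 1 - E kills B when B lies inside E. *)
Lemma alt_sum_absorb f B S E : E \in S -> B `<=` E -> alt_sum f B S = 0%R.
Proof.
elim: S B => //= F S IH B; rewrite inE => /orP[/eqP<- /setIidl->|ES BE].
  by rewrite subrr.
by rewrite !IH // => x [/BE].
Qed.

(** The sum depends only on the maximal members of the family. *)
Lemma alt_sum_absorbed f B S R :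
  (forall F, F \in R -> exists2 E, E \in S & F `<=` E) ->
  alt_sum f B (R ++ S) = alt_sum f B S.
Proof.
elim: R B => //= F R IH B RS; rewrite !IH; last 2 first.
- by move=> G GR; apply: RS; rewrite inE GR orbT.
- by move=> G GR; apply: RS; rewrite inE GR orbT.
have [E ES FE] := RS F (mem_head _ _).
have BFE : B `&` F `<=` E by move=> x [_ /FE].
by rewrite (alt_sum_absorb _ ES BFE) subr0.
Qed.

(** The product of the factors 1 - EF, for F in S, is
    1 - E + E prod (1 - F), because E is idempotent. *)
Lemma alt_sum_capl f B E S :
  alt_sum f B [seq E `&` F | F <- S]
  = (f B - f (B `&` E) + alt_sum f (B `&` E) S)%R.
Proof.
elim: S B => [|F S IH] B /=; first by lia.
have -> : B `&` (E `&` F) = B `&` E `&` F by rewrite setIA.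
have BEF : B `&` E `&` F `&` E = B `&` E `&` F by apply: setIidl => x [[]].
by rewrite !IH BEF; lia.
Qed.

Lemma alt_sum_comm f B S R : alt_sum f B (S ++ R) = alt_sum f B (R ++ S).
Proof.
elim: R B S => [|E R IH] B S; first by rewrite cats0.
rewrite /= -!IH; elim: S B => //= F S IHS B.
by rewrite !IHS setIAC; lia.
Qed.

(** With P_S the product of the 1 - E, for E in S, this is
    P_S P_R + P_(meets S R) = P_S + P_R. For the family E :: S it follows from
    P_(meets (E :: S) R) = (1 - E + E P_R) P_(meets S R), the case of S, and
    P_R P_(meets S R) = P_R, which holds by absorption. *)
Lemma alt_sum_meets f B S R :
  (alt_sum f B (S ++ R) + alt_sum f B (meets S R)
   = alt_sum f B S + alt_sum f B R)%R.
Proof.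
elim: S B => [|E S IH] B /=; first by rewrite addrC.
have absR X : alt_sum f X (meets S R ++ R) = alt_sum f X R.
  apply: alt_sum_absorbed => _ /allpairsP[[E' F] /= [_ FR ->]].
  by exists F => // x [].
have -> : alt_sum f B (meets (E :: S) R)
    = (alt_sum f B (meets S R) - alt_sum f (B `&` E) (meets S R)
       + alt_sum f (B `&` E) R)%R.
  rewrite [meets _ _]/= alt_sum_comm alt_sum_cat.
  under eq_alt_sum do rewrite alt_sum_capl.
  rewrite alt_sumD alt_sumB !alt_sum_shift.
  by rewrite (alt_sum_shift (fun X => alt_sum f X R)) -alt_sum_cat absR.
by have := IH B; have := IH (B `&` E); lia.
Qed.

(** Modularity, the source of the submodularity of the amalgam. *)
Lemma incl_excl_meets f S R :
  (incl_excl f (S ++ R) + incl_excl f (meets S R)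
   = incl_excl f S + incl_excl f R)%R.
Proof. by have := alt_sum_meets f setT S R; rewrite /incl_excl; lia. Qed.

Lemma incl_excl_nil f : incl_excl f [::] = 0%R.
Proof. exact: subrr. Qed.

Lemma incl_excl1 f E : incl_excl f [:: E] = f E.
Proof. by rewrite /incl_excl /= setTI; lia. Qed.

Lemma incl_excl_cons f E S :
  incl_excl f (E :: S)
  = (f E + incl_excl f S - incl_excl f [seq E `&` F | F <- S])%R.
Proof. by rewrite /incl_excl alt_sum_capl /= setTI; lia. Qed.

Lemma alt_sum_capr f A B S :
  alt_sum (fun X => f (X `&` A)) B S
  = alt_sum f (B `&` A) [seq E `&` A | E <- S].
Proof.
elim: S B => //= E S IH B.
by rewrite !IH setIACA setIid.
Qed.

Lemma eq_incl_excl_capr f A S R :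
  [seq E `&` A | E <- S] = [seq E `&` A | E <- R] ->
  incl_excl (fun X => f (X `&` A)) S = incl_excl (fun X => f (X `&` A)) R.
Proof. by move=> SR; rewrite /incl_excl !alt_sum_capr SR. Qed.

(** The recursive sum agrees with the sum over index sets: the two terms of a
    recursive step are the index sets avoiding and containing the new index. *)
Lemma alt_sum_subsets (I : finType) f B (E : I -> set T) (r : seq I) :
  uniq r ->
  alt_sum f B [seq E i | i <- r]
  = (\sum_(s : {set I} | s \subset [set i in r]%SET)
      (-1) ^+ #|s| * f (B `&` \bigcap_(i in [set` s]) E i))%R.
Proof.
elim: r B => [|a r IH] B /=.
  move=> _; rewrite (big_pred1 finset.set0) => [|s].
    rewrite cards0 expr0 mul1r.
    rewrite (_ : [set` finset.set0] = set0) ?bigcap_set0 ?setIT //.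
    by apply/seteqP; split => // x; rewrite /= inE.
  rewrite /= -finset.subset0.
  suff -> : [set i in Nil I]%SET = finset.set0 by [].
  by apply/finset.setP => x; rewrite !inE.
case/andP => ar ur; rewrite !IH // [RHS](bigID (fun s : {set I} => a \in s)) /=.
rewrite [RHS]addrC; congr (_ + _)%R.
  apply: eq_bigl => s; apply/idP/andP => [sr|[sr as_]].
    split; last by apply: contra ar => /(fintype.subsetP sr); rewrite inE.
    apply: fintype.subset_trans sr _; apply/fintype.subsetP => x.
    by rewrite !inE orbC => ->.
  apply/fintype.subsetP => x xs; have := fintype.subsetP sr _ xs.
  by rewrite !inE => /orP[/eqP xa|//]; rewrite -xa xs in as_.
(* Index sets containing a correspond to index sets inside r. *)
rewrite -sumrN.
rewrite [RHS](reindex_onto (fun s : {set I} => a |: s)%SET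
                      (fun s : {set I} => s :\ a)%SET) /=; last first.
  by move=> s /andP[_ as_]; rewrite finset.setD1K.
apply: eq_big => [s|s sr].
  rewrite finset.setU11 andbT; apply/idP/andP => [sr|[sr /eqP es]].
    split; last first.
      apply/eqP/finset.setU1K/(contra _ ar) => /(fintype.subsetP sr).
      by rewrite inE.
    apply/fintype.subsetP => x; rewrite !inE => /orP[->//|].
    by move=> /(fintype.subsetP sr); rewrite inE orbC => ->.
  apply/fintype.subsetP => x; rewrite -es !inE => /andP[xa].
  rewrite (negPf xa) /= => xs.
  by have := fintype.subsetP sr x; rewrite !inE (negPf xa) xs; apply.
have as_ : a \notin s.
  by apply: contra ar => /(fintype.subsetP sr); rewrite inE.
rewrite cardsU1 as_ exprS mulN1r mulNr -setIA; congr (- (_ * f (_ `&` _)))%R.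
apply/seteqP; split => x /=.
  move=> [Ex Esx] i; rewrite /= !inE => /orP[/eqP-> //|]; exact: Esx.
by move=> Ex; split=> [|i /= is_]; apply: Ex; rewrite /= !inE ?eqxx ?is_ ?orbT.
Qed.

Lemma codom_nth S : codom (fun i : 'I_(size S) => nth set0 S i) = S.
Proof.
rewrite /codom /image_mem (map_comp (nth set0 S) val) val_enum_ord.
exact: mkseq_nth.
Qed.

Lemma incl_exclE k f (E : 'I_k -> set T) :
  (\sum_(s : {set 'I_k} | s != finset.set0)
     (-1) ^+ (#|s|.+1) * f (\bigcap_(i in [set` s]) E i))%R
  = incl_excl f (codom E).
Proof.
rewrite /incl_excl /codom /image_mem alt_sum_subsets ?enum_uniq //.
rewrite [X in _ = (_ - X)%R](bigD1 finset.set0) ?finset.sub0set //=.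
rewrite cards0 expr0 mul1r.
rewrite (_ : [set` finset.set0] = set0); last first.
  by apply/seteqP; split => // x; rewrite /= inE.
rewrite bigcap_set0 setTI opprD addrA subrr sub0r -sumrN.
apply: eq_big => s.
  rewrite (_ : s \subset _) //; apply/fintype.subsetP => x _.
  by rewrite inE mem_enum.
by move=> _; rewrite exprS mulN1r mulNr setTI.
Qed.

End InclusionExclusion.

(** * Dimension and closure in a pregeometry *)

Section Dimension.
Variables (T : choiceType) (G : pregeometry T).
Implicit Types (A B C : {fset T}) (Y Z E : set T).

Lemma rk_sub A B : [set` B] `<=` carrier G -> (A `<=` B)%fset ->
  rk G A <= rk G B.
Proof.
move=> BG /fsetUidPl AB.
suff rkU C : [set` C] `<=` carrier G -> rk G A <= rk G (C `|` A)%fset.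
  by rewrite -AB; exact: rkU.
have AG : [set` A] `<=` carrier G.
  by move=> x /= xA; apply: BG; rewrite /= -AB inE xA orbT.
elim/fset1U_rect: C => [|x C _ IH]; first by rewrite fset0U.
rewrite set_fsetU1 subUset => -[xG CG].
rewrite -fsetUA; apply: leq_trans (IH CG) _.
have CAG : [set` (C `|` A)%fset] `<=` carrier G.
  by rewrite set_fsetU subUset.
by have /andP[] := rk_step CAG (xG x erefl).
Qed.

Lemma rk_le_card A : [set` A] `<=` carrier G -> rk G A <= #|` A|.
Proof.
elim/fset1U_rect: A => [|x A xA IH]; first by rewrite rk_fset0.
rewrite set_fsetU1 subUset => -[xG AG].
rewrite cardfsU1 xA add1n; have /andP[_] := rk_step AG (xG x erefl).
by move=> /leq_trans -> //; rewrite ltnS IH.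
Qed.

(** Diminishing returns, the form in which submodularity governs closure: what
    lies in the closure of A lies in that of B. *)
Lemma rk_gain A B x : [set` B] `<=` carrier G -> carrier G x ->
  (A `<=` B)%fset ->
  rk G (x |` B)%fset + rk G A <= rk G (x |` A)%fset + rk G B.
Proof.
move=> BG xG AB.
have AG : [set` A] `<=` carrier G.
  by move=> y yA; apply/BG/(fsubsetP AB).
have xAG : [set` (x |` A)%fset] `<=` carrier G.
  by rewrite set_fsetU1 subUset; split => // _ ->.
have := rk_submod xAG BG.
rewrite -fsetUA (fsetUidPr _ _ AB) => /(leq_trans _); apply.
rewrite leq_add2l; apply: rk_sub.
  by move=> y /=; rewrite inE => /andP[_ /BG].
by rewrite fsubsetI fsubsetU1 AB.
Qed.

Lemma exists_basis A : [set` A] `<=` carrier G ->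
  exists B, [/\ (B `<=` A)%fset, rk G B = rk G A & independent G B].
Proof.
elim/fset1U_rect: A => [|x A xA IH].
  by exists fset0; split=> //; rewrite /independent rk_fset0 cardfs0.
rewrite set_fsetU1 subUset => -[xG AG].
have [B [BA rkB iB]] := IH AG; have {}xG := xG x erefl.
have /andP[] := rk_step AG xG; rewrite leq_eqVlt => /orP[/eqP rkA _|rkA rkA'].
  exists B; split=> //; last by rewrite rkB.
  exact: fsubset_trans BA (fsubsetU1 _ _).
have BG : [set` B] `<=` carrier G by move=> y yB; apply/AG/(fsubsetP BA).
have gain := rk_gain AG xG BA; have /andP[_ step] := rk_step BG xG.
have rkxB : rk G (x |` B)%fset = (rk G A).+1 by lia.
exists (x |` B)%fset; split; first by rewrite fsetUS.
  by lia.
have xB : x \notin B by apply: contra xA => /(fsubsetP BA).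
by rewrite /independent rkxB cardfsU1 xB add1n -iB rkB.
Qed.

(** Dimension is defined through sizes of independent sets; this bound and
    [pdimP] let later arguments speak of ranks of arbitrary finite subsets. *)
Lemma pdim_le Y n : (forall B, [set` B] `<=` Y -> rk G B <= n) ->
  finite_dim G Y /\ pdim G Y <= n.
Proof.
move=> Yn.
have ubn : ubound (indep_sizes G Y) n.
  by move=> m [A [AY <- <-]]; exact: Yn.
have fY : finite_dim G Y by exists n.
split=> //; rewrite /pdim /supremum; case: ifP => // _.
have [_ lb] := xgetPex 0 (nat_supremums_neq0 fY).
by have := lb _ ubn; rewrite leEnat.
Qed.

Lemma pdimP Y : Y `<=` carrier G -> finite_dim G Y ->
  (exists2 A, [set` A] `<=` Y & rk G A = pdim G Y) /\
  (forall B, [set` B] `<=` Y -> rk G B <= pdim G Y).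
Proof.
move=> YG fY.
have i0 : indep_sizes G Y 0.
  by exists fset0; rewrite set_fset0 /independent rk_fset0 cardfs0; split.
have [ub lb] := xgetPex 0 (nat_supremums_neq0 fY).
have -> : pdim G Y = xget 0 (supremums (indep_sizes G Y)).
  by rewrite /pdim /supremum ifF //; apply/negP => /eqP s0; rewrite s0 in i0.
move: (xget 0 _) ub lb => m ub lb; split.
  have [e|m0] := posnP m; first by exists fset0; rewrite ?set_fset0 ?rk_fset0.
  (* The supremum is attained, as its predecessor is not an upper bound. *)
  have /existsNP[n /not_implyP[[A [AY iA An]] /negP]] :
      ~ ubound (indep_sizes G Y) m.-1.
    by move=> /lb; rewrite leEnat; lia.
  rewrite leEnat => nm; exists A => //.
  have := ub n; rewrite leEnat => /(_ (ex_intro _ A (And3 AY iA An))).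
  by rewrite iA An; lia.
move=> B BY; have [C [CB <- iC]] := exists_basis (subset_trans BY YG).
have := ub (rk G C); rewrite leEnat; apply; exists C; split => //.
by move=> y yC; apply/BY/(fsubsetP CB).
Qed.

Lemma rk_le_pdim Y B : Y `<=` carrier G -> finite_dim G Y ->
  [set` B] `<=` Y -> rk G B <= pdim G Y.
Proof. by move=> YG fY; have [_] := pdimP YG fY; apply. Qed.

Lemma finite_dim_sub Y Z : Z `<=` Y -> finite_dim G Y -> finite_dim G Z.
Proof.
move=> ZY; apply: subset_has_ubound => n [A [AZ iA An]].
by exists A; split=> //; exact: subset_trans ZY.
Qed.

Lemma pdim_sub Y Z : Y `<=` carrier G -> finite_dim G Y -> Z `<=` Y ->
  pdim G Z <= pdim G Y.
Proof.
move=> YG fY ZY.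
have [] // := @pdim_le Z (pdim G Y).
by move=> B BZ; apply: rk_le_pdim => //; exact: subset_trans ZY.
Qed.

Definition fd_closed E := closed_in G E /\ finite_dim G E.

Lemma closed_inP E : closed_in G E <->
  E `<=` carrier G /\ forall A, [set` A] `<=` E -> cl_fin G A `<=` E.
Proof.
split=> [clE|[EG clE]].
  split=> [x|A AE x xA]; rewrite -clE; last by exists A.
  by case=> A _ [].
apply/seteqP; split=> [x [A AE]|x Ex]; first exact: clE.
exists [fset x]%fset; first by rewrite /= set_fset1 => _ ->.
by split; [exact: EG|rewrite fsetUid].
Qed.

Lemma closed_carrier E : closed_in G E -> E `<=` carrier G.
Proof. by case/closed_inP. Qed.

Lemma fd_closed_bigcap (I : Type) (P : set I) (E : I -> set T) :
  P !=set0 -> (forall i, P i -> fd_closed (E i)) ->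
  fd_closed (\bigcap_(i in P) E i).
Proof.
move=> [i0 Pi0] clE; split; last first.
  by apply: finite_dim_sub (proj2 (clE _ Pi0)) => x; exact.
apply/closed_inP; split=> [x Ex|A AE x xA i Pi].
  by apply: closed_carrier (proj1 (clE _ Pi0)) _ _; exact: Ex.
have [/closed_inP[_ cli] _] := clE _ Pi; apply: cli xA.
by move=> y /AE; exact.
Qed.

Lemma fd_closedI E F : fd_closed E -> fd_closed F -> fd_closed (E `&` F).
Proof.
move=> clE clF.
have -> : E `&` F = \bigcap_(b in setT) (if b then E else F).
  apply/seteqP; split=> [x [Ex Fx] []//|x EFx].
  by split; [exact: (EFx true)|exact: (EFx false)].
by apply: fd_closed_bigcap => [|[]]; first by exists true.
Qed.

Lemma rk_cl_finU A B : [set` A] `<=` carrier G -> [set` B] `<=` cl_fin G A ->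
  rk G (B `|` A)%fset = rk G A.
Proof.
move=> AG; elim/fset1U_rect: B => [|x B _ IH]; first by rewrite fset0U.
rewrite set_fsetU1 subUset => -[xA BA]; have [xG rkx] := xA x erefl.
have BAG : [set` (B `|` A)%fset] `<=` carrier G.
  by rewrite set_fsetU subUset; split=> // y /BA[].
have := rk_gain BAG xG (fsubsetUr B A); have /andP[] := rk_step BAG xG.
by rewrite fsetUA -fsetUA rkx (IH BA); lia.
Qed.

Lemma sub_cl_fin A : [set` A] `<=` carrier G -> [set` A] `<=` cl_fin G A.
Proof.
move=> AG x /= xA; split; first exact: AG.
by congr (rk G _); apply: mem_fset1U.
Qed.

Lemma cl_finP A : [set` A] `<=` carrier G ->
  fd_closed (cl_fin G A) /\ pdim G (cl_fin G A) = rk G A.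
Proof.
move=> AG.
have rkB B : [set` B] `<=` cl_fin G A -> rk G B <= rk G A.
  move=> BA; rewrite -(rk_cl_finU AG BA); apply: rk_sub (fsubsetUl _ _).
  by rewrite set_fsetU subUset; split=> // y /BA[].
have [fA dA] := pdim_le rkB.
have clAG : cl_fin G A `<=` carrier G by move=> x [].
split; last first.
  by apply/eqP; rewrite eqn_leq dA rk_le_pdim //; exact: sub_cl_fin.
split=> //; apply/closed_inP; split=> // B BA x [xG xB]; split=> //.
have BAG : [set` (B `|` A)%fset] `<=` carrier G.
  by rewrite set_fsetU subUset; split=> // y /BA[].
have := rk_gain BAG xG (fsubsetUl B A); have /andP[] := rk_step AG xG.
have : rk G (x |` A)%fset <= rk G (x |` (B `|` A))%fset.
  apply: rk_sub; last by rewrite fsetUS // fsubsetUr.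
  by rewrite set_fsetU1 subUset; split=> // _ ->.
by rewrite (rk_cl_finU AG BA) xB; lia.
Qed.

(** A closed set of finite dimension is the closure of a finite subset,
    although it may itself be infinite. *)
Lemma fd_closed_basis E : fd_closed E ->
  exists A, [/\ [set` A] `<=` E, rk G A = pdim G E & cl_fin G A = E].
Proof.
move=> [/closed_inP[EG clE] fE]; have [[A AE rkA] rkE] := pdimP EG fE.
exists A; split=> //; apply/seteqP; split; first exact: clE.
move=> x Ex; split; first exact: EG.
have xAE : [set` (x |` A)%fset] `<=` E.
  by rewrite set_fsetU1 subUset; split=> // _ ->.
apply/eqP; rewrite eqn_leq [X in _ <= X]rkA rkE //=.
apply: rk_sub; last exact: fsubsetU1.
by move=> y /xAE /EG.
Qed.

(** Dimension as a function of subsets of the ambient type, so that one family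
    of sets can be measured in several pregeometries at once. *)
Definition dim_trace (X : set T) : int := (pdim G (X `&` carrier G))%:Z.

Lemma Delta_dim_trace k (E : 'I_k -> set T) :
  Delta G (fun i => E i `&` carrier G) = incl_excl dim_trace (codom E).
Proof.
rewrite -incl_exclE; apply: eq_bigr => s /finset.set0Pn[i is_].
by rewrite bigcapIl //; exists i.
Qed.

Lemma flat_cover (S : seq (set T)) : flat G ->
  (forall E, E \in S -> fd_closed (E `&` carrier G)) ->
  ((pdim G (cover S `&` carrier G))%:Z <= incl_excl dim_trace S)%R.
Proof.
move=> flG clS.
pose E (i : 'I_(size S)) := nth set0 S i.
have codE : codom E = S := codom_nth S.
have := flG _ (fun i => E i `&` carrier G); rewrite Delta_dim_trace codE.
rewrite (_ : \bigcup_i _ = cover S `&` carrier G); first apply.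
  by move=> i; apply: clS; exact: mem_nth.
apply/seteqP; split=> [x [i _ [Ex Gx]]|x [[F FS Fx] Gx]].
  by split=> //; exists (E i) => //=; exact: mem_nth.
move: FS => /= /(nthP set0)[i iS EF].
by exists (Ordinal iS) => //; rewrite /E /= EF.
Qed.

End Dimension.

(** Submodularity of rank bounds a finite subset of the union by its two
    parts. *)
Lemma finite_dimU (T : choiceType) (G : pregeometry T) (Y Z : set T) :
  Y `<=` carrier G -> Z `<=` carrier G ->
  finite_dim G Y -> finite_dim G Z -> finite_dim G (Y `|` Z).
Proof.
move=> YG ZG fY fZ.
have [] // := @pdim_le _ G (Y `|` Z) (pdim G Y + pdim G Z) => B BYZ.
pose C := [fset x in B | `[< Y x >]]%fset.
pose D := [fset x in B | `[< Z x >]]%fset.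
have CY : [set` C] `<=` Y by move=> x /=; rewrite !inE => /andP[_ /asboolP].
have DZ : [set` D] `<=` Z by move=> x /=; rewrite !inE => /andP[_ /asboolP].
have CDG : [set` (C `|` D)%fset] `<=` carrier G.
  by rewrite set_fsetU subUset; split; [move=> x /CY /YG|move=> x /DZ /ZG].
have BCD : (B `<=` C `|` D)%fset.
  apply/fsubsetP => x xB; rewrite !inE xB /=.
  by case: (BYZ _ xB) => /asboolP ->; rewrite ?orbT.
have := rk_submod (subset_trans CY YG) (subset_trans DZ ZG).
have := rk_le_pdim YG fY CY; have := rk_le_pdim ZG fZ DZ.
by have := rk_sub CDG BCD; lia.
Qed.

Lemma finite_dim_cover (T : choiceType) (G : pregeometry T) (S : seq (set T)) :
  (forall E, E \in S -> fd_closed G (E `&` carrier G)) ->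
  finite_dim G (cover S `&` carrier G).
Proof.
elim: S => [_|E S IH clS].
  apply: (@finite_dim_sub _ _ set0); first by move=> x [[]].
  have [] // := @pdim_le _ G set0 0 => B B0.
  have [->|[x /B0 //]] := fset_0Vmem B; by rewrite rk_fset0.
rewrite cover_cons setIUl; apply: finite_dimU => //.
  exact: (clS E (mem_head _ _)).2.
by apply: IH => F FS; apply: clS; rewrite inE FS orbT.
Qed.

(** * Restriction to a subpregeometry *)

Section Restriction.
Variables (T : choiceType) (H G : pregeometry T).
Hypothesis HG : subpregeometry H G.
Implicit Types (A B : {fset T}) (Y E : set T) (S : seq (set T)).

Lemma indep_sizes_restr Y : Y `<=` carrier H ->
  indep_sizes H Y = indep_sizes G Y.
Proof.
move=> YH; apply/seteqP; split=> n [A [AY iA An]]; exists A; split=> //.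
  by rewrite /independent -(proj2 HG) //; exact: subset_trans YH.
by rewrite /independent (proj2 HG) //; exact: subset_trans YH.
Qed.

(** For a basis A of a closed set of H, this makes that set the trace on H of
    its closure in G. *)
Lemma cl_fin_restr A : [set` A] `<=` carrier H ->
  cl_fin H A = cl_fin G A `&` carrier H.
Proof.
have [sHG rkH] := HG; move=> AH.
have rkx x : carrier H x -> rk H (x |` A)%fset = rk G (x |` A)%fset.
  by move=> xH; apply: rkH; rewrite set_fsetU1 subUset; split=> // _ ->.
apply/seteqP; split=> [x [xH e]|x [[xG e] xH]].
  by split=> //; split; [exact: sHG|rewrite -rkx // e rkH].
by split=> //; rewrite rkx // e rkH.
Qed.

Lemma fd_closed_restr E : fd_closed G E -> fd_closed H (E `&` carrier H).
Proof.
move=> [/closed_inP[EG clE] fE]; split; last first.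
  rewrite /finite_dim indep_sizes_restr //.
  by apply: finite_dim_sub fE => x [].
apply/closed_inP; split=> // A AE.
rewrite cl_fin_restr; last by move=> x /AE[].
by move=> x [xA xH]; split=> //; apply: clE xA => y /AE[].
Qed.

Lemma strong_cover S : strong H G ->
  (forall E, E \in S -> fd_closed G (E `&` carrier G)) ->
  (incl_excl (dim_trace H) S <= incl_excl (dim_trace G) S)%R.
Proof.
move=> [_ stHG] clS.
pose E (i : 'I_(size S)) := nth set0 S i.
have codE : codom E = S := codom_nth S.
have := stHG _ (fun i => E i `&` carrier G).
have -> : (fun i => E i `&` carrier G `&` carrier H)
          = (fun i => E i `&` carrier H).
  apply/funext => i; rewrite -setIA; congr (_ `&` _).
  by apply: setIidr; exact: (proj1 HG).
rewrite !Delta_dim_trace codE; apply => i.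
by apply: clS; exact: mem_nth.
Qed.

End Restriction.

(** * Relative dimension over a strong subpregeometry *)

(** Flatness relative to a strong H. Let F be the closure in G of the trace of
    E on H, so that F and E have the same trace on H and F has the dimension of
    that trace. Flatness of F :: S gives
      d E <= d F + Delta_G S - Delta_G (F n S),
    and strength bounds Delta_G (F n S) below by Delta_H (F n S), which is
    Delta_H S since the traces on H of members of S already lie in F. *)
Lemma strong_rel_dim_le (T : choiceType) (H G : pregeometry T)
    (S : seq (set T)) (E : set T) :
  flat G -> strong H G ->
  (forall F, F \in S -> fd_closed G (F `&` carrier G)) ->
  fd_closed G E -> cover S `&` carrier G `<=` E ->
  pdim G E <= pdim G (cover S `&` carrier G) ->
  (dim_trace G E - dim_trace H E
   <= incl_excl (dim_trace G) S - incl_excl (dim_trace H) S)%R.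
Proof.
move=> flG stHG clS clE SE dES; have [HG _] := stHG.
have EG := closed_carrier clE.1.
have [A [AE0 rkA clA]] := fd_closed_basis (fd_closed_restr HG clE).
have AH : [set` A] `<=` carrier H by move=> x /AE0[].
have AG : [set` A] `<=` carrier G by move=> x /AH /(proj1 HG).
pose F := cl_fin G A.
have [clF dF] := cl_finP AG.
have FG := closed_carrier clF.1.
have FE : F `<=` E.
  by have /closed_inP[_] := clE.1; apply => x /AE0[].
have FH : F `&` carrier H = E `&` carrier H by rewrite -cl_fin_restr.
have clFS : forall X, X \in F :: S -> fd_closed G (X `&` carrier G).
  move=> X; rewrite inE => /orP[/eqP->|/clS//].
  by rewrite (setIidl FG).
have := flat_cover flG clFS.
rewrite incl_excl_cons {1}/dim_trace (setIidl FG) -/F dF.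
(* F contains every trace on H, so meeting with F changes nothing in H. *)
have : incl_excl (dim_trace H) [seq F `&` X | X <- S]
       = incl_excl (dim_trace H) S.
  apply: (@eq_incl_excl_capr _ (fun X => (pdim H X)%:Z%R)).
  rewrite -map_comp; apply/eq_in_map => X XS /=.
  rewrite -setIA setIidr // => x [Xx xH].
  have [//] : (F `&` carrier H) x.
  rewrite FH; split=> //; apply: SE; split; first by exists X.
  exact: (proj1 HG).
have : (incl_excl (dim_trace H) [seq F `&` X | X <- S]
        <= incl_excl (dim_trace G) [seq F `&` X | X <- S])%R.
  apply: strong_cover => // _ /mapP[X XS ->].
  rewrite -[carrier G]setIid setIACA; apply: fd_closedI; last exact: clS.
  by rewrite (setIidl FG).
have : pdim G E <= pdim G (cover (F :: S) `&` carrier G).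
  apply: leq_trans dES _; apply: pdim_sub => //.
    exact: finite_dim_cover clFS.
  by rewrite cover_cons setIUl.
rewrite /dim_trace (setIidl EG) -rkA (proj2 HG) //.
by lia.
Qed.

(** * Gluing two pregeometries along a common strong part *)

Section Sides.
Variables (T : choiceType) (G1 G2 H : pregeometry T).
Hypothesis carH : carrier H = carrier G1 `&` carrier G2.

(** A closed set F of G1 is continued into G2 by the closure in G2 of its trace
    on H. The closure adds no point of H, hence no point of G1, and no
    dimension. *)
Lemma glue_extend (F : set T) :
  subpregeometry H G1 -> subpregeometry H G2 -> fd_closed G1 F ->
  exists E, [/\ E `<=` carrier G1 `|` carrier G2, E `&` carrier G1 = F,
    fd_closed G2 (E `&` carrier G2) & dim_trace G2 E = dim_trace H E].
Proof.
move=> HG1 HG2 clF; have FG1 := closed_carrier clF.1.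
have [A [AF rkA clA]] := fd_closed_basis (fd_closed_restr HG1 clF).
have AH : [set` A] `<=` carrier H by move=> x /AF[].
have AG2 : [set` A] `<=` carrier G2 by move=> x /AH /(proj1 HG2).
have [clF2 dF2] := cl_finP AG2; have F2G := closed_carrier clF2.1.
have F2H : cl_fin G2 A `&` carrier H = F `&` carrier H.
  by rewrite -cl_fin_restr.
exists (F `|` cl_fin G2 A).
have EG1 : (F `|` cl_fin G2 A) `&` carrier G1 = F.
  rewrite setIUl (setIidl FG1); apply/setUidPl => x [F2x xG1].
  have [//] : (F `&` carrier H) x.
  by rewrite -F2H carH; split=> //; split=> //; exact: F2G.
have EG2 : (F `|` cl_fin G2 A) `&` carrier G2 = cl_fin G2 A.
  rewrite setIUl (setIidl F2G); apply/setUidPr => x [Fx xG2].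
  have [//] : (cl_fin G2 A `&` carrier H) x.
  by rewrite F2H carH; split=> //; split=> //; exact: FG1.
split=> //; last 2 first.
- by rewrite EG2.
- rewrite /dim_trace EG2 carH setIA EG1 dF2 -(proj2 HG2) // rkA carH setIA.
  by rewrite (setIidl FG1).
by move=> x [/FG1|/F2G]; [left|right].
Qed.

(** Flatness of G1 bounds the first summand below; the bracket, the contribution
    of G2 outside H, is nonnegative by strength. *)
Lemma glue_lower_bound (S : seq (set T)) (A : {fset T}) :
  flat G1 -> strong H G2 ->
  (forall E, E \in S -> fd_closed G1 (E `&` carrier G1)) ->
  (forall E, E \in S -> fd_closed G2 (E `&` carrier G2)) ->
  [set` A] `<=` cover S -> [set` A] `<=` carrier G1 ->
  ((rk G1 A)%:Z <= incl_excl (dim_trace G1) S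
     + (incl_excl (dim_trace G2) S - incl_excl (dim_trace H) S))%R.
Proof.
move=> fl1 st2 cl1 cl2 AS AG1.
have AS1 : [set` A] `<=` cover S `&` carrier G1.
  by move=> x xA; split; [exact: AS|exact: AG1].
have := rk_le_pdim (@subIsetr _ _ _) (finite_dim_cover cl1) AS1.
have := flat_cover fl1 cl1; have := strong_cover (proj1 st2) st2 cl2.
by lia.
Qed.

End Sides.

Section Amalgam.
Variables (T : choiceType) (G1 G2 H : pregeometry T).
Hypotheses (fl1 : flat G1) (fl2 : flat G2) (flH : flat H).
Hypothesis carH : carrier H = carrier G1 `&` carrier G2.
Hypotheses (st1 : strong H G1) (st2 : strong H G2).
Implicit Types (A B : {fset T}) (E X : set T) (S R : seq (set T)).

Let carH' : carrier H = carrier G2 `&` carrier G1.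
Proof. by rewrite carH setIC. Qed.

Let M := carrier G1 `|` carrier G2.

Definition glued_closed E := [/\ E `<=` M, fd_closed G1 (E `&` carrier G1)
  & fd_closed G2 (E `&` carrier G2)].

Definition glued_family S := forall E, E \in S -> glued_closed E.

Definition glued_dim X : int :=
  (dim_trace G1 X + dim_trace G2 X - dim_trace H X)%R.

Definition predim S : int :=
  (incl_excl (dim_trace G1) S + incl_excl (dim_trace G2) S
   - incl_excl (dim_trace H) S)%R.

Lemma glued_closed1 S : glued_family S ->
  forall E, E \in S -> fd_closed G1 (E `&` carrier G1).
Proof. by move=> gS E /gS[]. Qed.

Lemma glued_closed2 S : glued_family S ->
  forall E, E \in S -> fd_closed G2 (E `&` carrier G2).
Proof. by move=> gS E /gS[]. Qed.

Lemma glued_closedH S : glued_family S ->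
  forall E, E \in S -> fd_closed H (E `&` carrier H).
Proof.
move=> gS E /gS[_ clE _]; have := fd_closed_restr (proj1 st1) clE.
by rewrite -setIA (setIidr (proj1 (proj1 st1))).
Qed.

Lemma glued_closedI E X : glued_closed E -> glued_closed X ->
  glued_closed (E `&` X).
Proof.
move=> [EM E1 E2] [XM X1 X2]; split; first by move=> x [/EM].
  by rewrite -[carrier G1]setIid setIACA; exact: fd_closedI.
by rewrite -[carrier G2]setIid setIACA; exact: fd_closedI.
Qed.

Lemma glued_family_cat S R : glued_family S -> glued_family R ->
  glued_family (S ++ R).
Proof. by move=> gS gR E; rewrite mem_cat => /orP[/gS|/gR]. Qed.

Lemma glued_family_meets S R : glued_family S -> glued_family R ->
  glued_family (meets S R).
Proof.
move=> gS gR _ /allpairsP[[E X] /= [ES XR ->]].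
by apply: glued_closedI; [exact: gS|exact: gR].
Qed.

Lemma predim_meets S R :
  (predim (S ++ R) + predim (meets S R) = predim S + predim R)%R.
Proof.
have e1 := incl_excl_meets (dim_trace G1) S R.
have e2 := incl_excl_meets (dim_trace G2) S R.
have e3 := incl_excl_meets (dim_trace H) S R.
by rewrite /predim; lia.
Qed.

Lemma predim1 E : predim [:: E] = glued_dim E.
Proof. by rewrite /predim !incl_excl1. Qed.

(** With A empty this says that predimensions are nonnegative, which is what
    makes their minimum exist. *)
Lemma rk1_le_predim S A : glued_family S -> [set` A] `<=` cover S ->
  [set` A] `<=` carrier G1 -> ((rk G1 A)%:Z <= predim S)%R.
Proof.
move=> gS AS A1.
have := glue_lower_bound fl1 st2 (glued_closed1 gS) (glued_closed2 gS) AS A1.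
by rewrite /predim; lia.
Qed.

Lemma rk2_le_predim S A : glued_family S -> [set` A] `<=` cover S ->
  [set` A] `<=` carrier G2 -> ((rk G2 A)%:Z <= predim S)%R.
Proof.
move=> gS AS A2.
have := glue_lower_bound fl2 st1 (glued_closed2 gS) (glued_closed1 gS) AS A2.
by rewrite /predim; lia.
Qed.

Lemma predim_ge0 S : glued_family S -> (0 <= predim S)%R.
Proof.
move=> gS; have := @rk1_le_predim S fset0 gS.
by rewrite set_fset0 rk_fset0; apply.
Qed.

Lemma extend1 A : [set` A] `<=` carrier G1 ->
  exists E, [/\ glued_closed E, [set` A] `<=` E & glued_dim E = (rk G1 A)%:Z%R].
Proof.
move=> A1; have [clF dF] := cl_finP A1.
have [E [EM EF E2 dE]] := glue_extend carH (proj1 st1) (proj1 st2) clF.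
exists E; split; first by split=> //; rewrite EF.
  by move=> x /(sub_cl_fin A1); rewrite -EF => -[].
by rewrite /glued_dim dE {1}/dim_trace EF dF; lia.
Qed.

Lemma extend2 A : [set` A] `<=` carrier G2 ->
  exists E, [/\ glued_closed E, [set` A] `<=` E & glued_dim E = (rk G2 A)%:Z%R].
Proof.
move=> A2; have [clF dF] := cl_finP A2.
have [E [EM EF E1 dE]] := glue_extend carH' (proj1 st2) (proj1 st1) clF.
exists E; split; first by split=> //; [rewrite /M setUC|rewrite EF].
  by move=> x /(sub_cl_fin A2); rewrite -EF => -[].
by rewrite /glued_dim dE {2}/dim_trace EF dF; lia.
Qed.

Lemma exists_cover A : [set` A] `<=` M ->
  exists2 S, glued_family S & [set` A] `<=` cover S.
Proof.
move=> AM.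
pose B := [fset x in A | `[< carrier G1 x >]]%fset.
pose C := [fset x in A | `[< carrier G2 x >]]%fset.
have [|E [gE BE _]] := @extend1 B.
  by move=> x /=; rewrite !inE => /andP[_ /asboolP].
have [|F [gF CF _]] := @extend2 C.
  by move=> x /=; rewrite !inE => /andP[_ /asboolP].
exists [:: E; F]; first by move=> X; rewrite !inE => /orP[/eqP->|/eqP->].
move=> x xA; rewrite !cover_cons.
have [x1|x2] := AM x xA; [left; apply: BE|right; left; apply: CF].
  by rewrite /= !inE xA; apply/asboolP.
by rewrite /= !inE xA; apply/asboolP.
Qed.

Definition is_glued_rk A (n : nat) :=
  (exists S, [/\ glued_family S, [set` A] `<=` cover S & predim S = n%:Z%R]) /\
  (forall S, glued_family S -> [set` A] `<=` cover S -> (n%:Z <= predim S)%R).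

Definition glued_rk A : nat := xget 0 (is_glued_rk A).

(** Predimensions are integers, so the minimum is sought among the absolute
    values of those of covering families. *)
Lemma glued_rkP A : [set` A] `<=` M -> is_glued_rk A (glued_rk A).
Proof.
move=> AM; apply: xgetPex.
pose P n := `[< exists S,
  [/\ glued_family S, [set` A] `<=` cover S & predim S = n%:Z%R] >].
have Ppredim S : glued_family S -> [set` A] `<=` cover S -> P `|predim S|%N.
  move=> gS AS; apply/asboolP; exists S; split=> //.
  by rewrite gez0_abs // predim_ge0.
have exP : exists n, P n.
  by have [S gS AS] := exists_cover AM; exists `|predim S|%N; exact: Ppredim.
case: (ex_minnP exP) => n /asboolP Pn minn; exists n; split=> // S gS AS.
by have := minn _ (Ppredim S gS AS); have := predim_ge0 gS; lia.
Qed.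

Lemma glued_rk_le A S : [set` A] `<=` M -> glued_family S ->
  [set` A] `<=` cover S -> ((glued_rk A)%:Z <= predim S)%R.
Proof. by move=> AM; have [_] := glued_rkP AM; apply. Qed.

Lemma glued_rk0 : glued_rk fset0 = 0.
Proof.
have A0 : [set` fset0] `<=` M by rewrite set_fset0.
suff : ((glued_rk fset0)%:Z <= predim [::])%R.
  by rewrite /predim !incl_excl_nil; lia.
by apply: glued_rk_le => //; rewrite set_fset0.
Qed.

Lemma glued_rk_eq1 A : [set` A] `<=` carrier G1 -> glued_rk A = rk G1 A.
Proof.
move=> A1; have AM : [set` A] `<=` M by move=> x /A1; left.
have [E [gE AE dE]] := extend1 A1.
have [[S [gS AS dS]] _] := glued_rkP AM.
have := rk1_le_predim gS AS A1.
have := @glued_rk_le A [:: E] AM; rewrite predim1 dE => le_rk.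
suff : ((glued_rk A)%:Z <= (rk G1 A)%:Z)%R by lia.
apply: le_rk; first by move=> X; rewrite inE => /eqP->.
by rewrite cover_cons => x /AE; left.
Qed.

Lemma glued_rk_eq2 A : [set` A] `<=` carrier G2 -> glued_rk A = rk G2 A.
Proof.
move=> A2; have AM : [set` A] `<=` M by move=> x /A2; right.
have [E [gE AE dE]] := extend2 A2.
have [[S [gS AS dS]] _] := glued_rkP AM.
have := rk2_le_predim gS AS A2.
have := @glued_rk_le A [:: E] AM; rewrite predim1 dE => le_rk.
suff : ((glued_rk A)%:Z <= (rk G2 A)%:Z)%R by lia.
apply: le_rk; first by move=> X; rewrite inE => /eqP->.
by rewrite cover_cons => x /AE; left.
Qed.

Lemma glued_rk_submod A B : [set` A] `<=` M -> [set` B] `<=` M ->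
  glued_rk (A `|` B)%fset + glued_rk (A `&` B)%fset
  <= glued_rk A + glued_rk B.
Proof.
move=> AM BM.
have [[S [gS AS dS]] _] := glued_rkP AM.
have [[R [gR BR dR]] _] := glued_rkP BM.
have ABM : [set` (A `|` B)%fset] `<=` M by rewrite set_fsetU subUset.
have IM : [set` (A `&` B)%fset] `<=` M by rewrite set_fsetI => x [/AM].
have := glued_rk_le ABM (glued_family_cat gS gR).
have := glued_rk_le IM (glued_family_meets gS gR).
rewrite cover_cat cover_meets set_fsetU set_fsetI.
move=> /(_ (setISS AS BR)) leI /(_ (setUSS AS BR)) leU.
by have := predim_meets S R; lia.
Qed.

Lemma glued_rk_step A x : [set` A] `<=` M -> M x ->
  glued_rk A <= glued_rk (x |` A)%fset <= (glued_rk A).+1.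
Proof.
move=> AM Mx.
have xM : [set` [fset x]%fset] `<=` M by rewrite set_fset1 => _ ->.
have xAM : [set` (x |` A)%fset] `<=` M by rewrite set_fsetU subUset.
apply/andP; split.
  have [[S [gS AS dS]] _] := glued_rkP xAM.
  have := glued_rk_le AM gS; rewrite dS => le_rk.
  suff : ((glued_rk A)%:Z <= (glued_rk (x |` A)%fset)%:Z)%R by lia.
  by apply: le_rk => y yA; apply: AS; rewrite /= !inE [y \in A]yA orbT.
have x1 : glued_rk [fset x]%fset <= 1.
  case: Mx => xG.
    have x1 : [set` [fset x]%fset] `<=` carrier G1 by rewrite set_fset1 => _ ->.
    by rewrite glued_rk_eq1 // (leq_trans (rk_le_card x1)) // cardfs1.
  have x2 : [set` [fset x]%fset] `<=` carrier G2 by rewrite set_fset1 => _ ->.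
  by rewrite glued_rk_eq2 // (leq_trans (rk_le_card x2)) // cardfs1.
by have := glued_rk_submod xM AM; lia.
Qed.

Definition amalgam : pregeometry T :=
  @Pregeometry T M glued_rk glued_rk0 glued_rk_step glued_rk_submod.

Lemma sub1_amalgam : subpregeometry G1 amalgam.
Proof.
by split=> [x ?|A A1]; [left|rewrite /= glued_rk_eq1].
Qed.

Lemma sub2_amalgam : subpregeometry G2 amalgam.
Proof.
by split=> [x ?|A A2]; [right|rewrite /= glued_rk_eq2].
Qed.

Lemma fd_closed_glued E : fd_closed amalgam E -> glued_closed E.
Proof.
move=> clE; split; first exact: (closed_carrier clE.1).
  exact: (fd_closed_restr sub1_amalgam clE).
exact: (fd_closed_restr sub2_amalgam clE).
Qed.

(** One inequality holds because E covers itself. For the other, let S be a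
    covering family of least predimension for a finite B that contains a basis
    of E and bases of its traces on G1, G2 and H. Minimality forces S inside E,
    as a point covered by S adds nothing to the rank of B. Now apply
    [strong_rel_dim_le] to G1 and to G2, and flatness of H, and add up the three
    bounds. *)
Lemma pdim_amalgam E : fd_closed amalgam E ->
  (pdim amalgam E)%:Z%R = glued_dim E.
Proof.
move=> clE; have gE := fd_closed_glued clE; have [EM E1 E2] := gE.
have EH : fd_closed H (E `&` carrier H).
  by apply: (@glued_closedH [:: E]); [move=> X|]; rewrite inE // => /eqP->.
have [A [AE rkA clA]] := fd_closed_basis clE.
have AM : [set` A] `<=` M by move=> x /AE /EM.
apply/eqP; rewrite eq_le; apply/andP; split.
  rewrite -rkA -predim1; apply: glued_rk_le => //.
    by move=> X; rewrite inE => /eqP->.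
  by rewrite cover_cons => x /AE; left.
have [B1 [B1E rkB1 _]] := fd_closed_basis E1.
have [B2 [B2E rkB2 _]] := fd_closed_basis E2.
have [B0 [B0E rkB0 _]] := fd_closed_basis EH.
pose B := (A `|` (B1 `|` (B2 `|` B0)))%fset.
have BE : [set` B] `<=` E.
  rewrite !set_fsetU !subUset; split=> //.
  by split; [move=> x /B1E[]|split; [move=> x /B2E[]|move=> x /B0E[]]].
have BM := subset_trans BE EM.
have [[S [gS BS dS]] minS] := glued_rkP BM.
have rkB : glued_rk B <= pdim amalgam E.
  exact: (@rk_le_pdim _ amalgam _ _ EM clE.2 BE).
have SE : cover S `<=` E.
  move=> x Sx; rewrite -clA.
  have Mx : M x by case: Sx => X /gS[XM _ _] /XM.
  split=> //=; apply/eqP; rewrite eqn_leq.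
  have /andP[-> _] := glued_rk_step AM Mx; rewrite andbT.
  have xBM : [set` (x |` B)%fset] `<=` carrier amalgam.
    by rewrite set_fsetU1 subUset; split=> // _ ->.
  have -> : glued_rk A = pdim amalgam E by [].
  apply: leq_trans rkB; apply: (@leq_trans (glued_rk (x |` B)%fset)).
    by apply: (@rk_sub _ amalgam) => //; rewrite fsetUS // fsubsetUl.
  suff : ((glued_rk (x |` B)%fset)%:Z <= predim S)%R by rewrite dS; lia.
  apply: glued_rk_le => //.
  by rewrite set_fsetU1 subUset; split=> // _ ->.
have side (G : pregeometry T) C :
    (forall X, X \in S -> fd_closed G (X `&` carrier G)) ->
    (C `<=` B)%fset -> [set` C] `<=` E `&` carrier G ->
    rk G C = pdim G (E `&` carrier G) ->
    pdim G (E `&` carrier G) <= pdim G (cover S `&` carrier G).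
  move=> clS CB CE <-; apply: rk_le_pdim => //.
    exact: finite_dim_cover clS.
  move=> x xC; split; last by have [] := CE x xC.
  by apply: BS; exact: (fsubsetP CB).
have rel (G : pregeometry T) : flat G -> strong H G ->
    (forall X, X \in S -> fd_closed G (X `&` carrier G)) ->
    fd_closed G (E `&` carrier G) ->
    pdim G (E `&` carrier G) <= pdim G (cover S `&` carrier G) ->
    (dim_trace G E - dim_trace H E
     <= incl_excl (dim_trace G) S - incl_excl (dim_trace H) S)%R.
  move=> flG stG clS clEG dE.
  have SEG : cover S `&` carrier G `<=` E `&` carrier G by exact: setSI.
  have := strong_rel_dim_le flG stG clS clEG SEG dE.
  by rewrite /dim_trace -!setIA setIid (setIidr (proj1 (proj1 stG))).
have B1B : (B1 `<=` B)%fset by apply/fsubsetP => x xB; rewrite !inE xB !orbT.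
have B2B : (B2 `<=` B)%fset by apply/fsubsetP => x xB; rewrite !inE xB !orbT.
have B0B : (B0 `<=` B)%fset by apply/fsubsetP => x xB; rewrite !inE xB !orbT.
have s1 := side _ _ (glued_closed1 gS) B1B B1E rkB1.
have s2 := side _ _ (glued_closed2 gS) B2B B2E rkB2.
have s0 := side _ _ (glued_closedH gS) B0B B0E rkB0.
have d1 := rel _ fl1 st1 (glued_closed1 gS) E1 s1.
have d2 := rel _ fl2 st2 (glued_closed2 gS) E2 s2.
have d0 := flat_cover flH (glued_closedH gS).
have dH : (dim_trace H E <= incl_excl (dim_trace H) S)%R.
  by apply: le_trans d0; rewrite lez_nat.
by move: dS; rewrite /predim /glued_dim; lia.
Qed.

Lemma Delta_amalgam k (E : 'I_k -> set T) : fd_closed_family amalgam E ->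
  Delta amalgam E = predim (codom E).
Proof.
move=> clE; rewrite /predim -!incl_exclE -big_split -sumrB.
apply: eq_bigr => s /finset.set0Pn[i is_] /=.
rewrite pdim_amalgam; last first.
  by apply: fd_closed_bigcap => [|j _]; [exists i|exact: clE].
by rewrite /glued_dim mulrBr mulrDr.
Qed.

Lemma codom_glued k (E : 'I_k -> set T) : fd_closed_family amalgam E ->
  glued_family (codom E).
Proof. by move=> clE _ /codomP[i ->]; apply: fd_closed_glued; exact: clE. Qed.

(** A family of closed sets is itself a candidate in the minimum that defines
    the rank of finite subsets of its union. *)
Lemma flat_amalgam : flat amalgam.
Proof.
move=> k E clE; have gE := codom_glued clE; rewrite Delta_amalgam //.
have bound B : [set` B] `<=` \bigcup_i E i ->
    rk amalgam B <= `|predim (codom E)|%N.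
  move=> BE.
  have BM : [set` B] `<=` M.
    by move=> x /BE[i _ Eix]; exact: (closed_carrier (clE i).1 Eix).
  suff : ((glued_rk B)%:Z <= predim (codom E))%R by rewrite /=; lia.
  apply: glued_rk_le => // x /BE[i _ Eix].
  by exists (E i) => //=; exact: codom_f.
by have [_] := pdim_le bound; have := predim_ge0 gE; lia.
Qed.

Lemma strong1_amalgam : strong G1 amalgam.
Proof.
split=> [|k E clE]; first exact: sub1_amalgam.
have gE := codom_glued clE.
rewrite Delta_amalgam // Delta_dim_trace.
have := strong_cover (proj1 st2) st2 (glued_closed2 gE).
by rewrite /predim; lia.
Qed.

Lemma strong2_amalgam : strong G2 amalgam.
Proof.
split=> [|k E clE]; first exact: sub2_amalgam.
have gE := codom_glued clE.
rewrite Delta_amalgam // Delta_dim_trace.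
have := strong_cover (proj1 st1) st1 (glued_closed1 gE).
by rewrite /predim; lia.
Qed.

End Amalgam.

Theorem corollary3p1p11 :
  forall (T : choiceType) (G1 G2 H : pregeometry T),
    flat G1 -> flat G2 -> flat H ->
    carrier H = (carrier G1 `&` carrier G2)%classic ->
    subpregeometry H G1 -> subpregeometry H G2 ->
    strong H G1 -> strong H G2 ->
    exists G : pregeometry T,
      [/\ flat G, strong G1 G, strong G2 G
        & carrier G = (carrier G1 `|` carrier G2)%classic].
Proof.
move=> T G1 G2 H fl1 fl2 flH carH _ _ st1 st2.
exists (amalgam fl1 fl2 carH st1 st2); split=> //.
- exact: flat_amalgam.
- exact: strong1_amalgam.
- exact: strong2_amalgam.
Qed.
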